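(* Every orientable mod $2$ characteristic map $\lambda^{\mathbb R}\colon V(K)\to\mathbb Z_2^4$ over a simplicial $3$-sphere $K$ admits a lift.
   Context: $\mathbb Z_2=\mathbb Z/2\mathbb Z$. A simplicial $3$-sphere is a (finite, abstract) simplicial complex whose geometric realization is homeomorphic to $S^3$. $V(K)$ is the vertex set of $K$; facets are maximal simplices. A mod $2$ characteristic map over $K$ is a map $\lambda^{\mathbb R}\colon V(K)\to\mathbb Z_2^4$ such that the images of the four vertices of every facet form a basis of $\mathbb Z_2^4$. It is called orientable if there is $g\in\mathrm{GL}(4,\mathbb Z_2)$ such that for every vertex $v$ the vector $g\lambda^{\mathbb R}(v)$ has odd coordinate sum (i.e. its coordinates sum to $1$ in $\mathbb Z_2$). An integral characteristic map over $K$ is a map $\lambda\colon V(K)\to\mathbb Z^4$ such that the images of the four vertices of every facet form a basis of $\mathbb Z^4$. A lift of $\lambda^{\mathbb R}$ is an integral characteristic map $\lambda$ over $K$ with $\lambda(v)\equiv\lambda^{\mathbb R}(v)\pmod 2$ for every vertex $v$. *)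

(* Defs.v *)
From HB Require Import structures.
From mathcomp Require Import all_boot all_order all_algebra.
From mathcomp Require Import all_classical all_reals all_analysis.

Set Implicit Arguments.
Unset Strict Implicit.
Unset Printing Implicit Defensive.

Import Order.TTheory GRing.Theory Num.Theory.
Import numFieldNormedType.Exports.

Local Open Scope ring_scope.

Definition homeomorphic (S T : topologicalType) : Prop :=
  exists (f : S -> T) (g : T -> S),
    [/\ continuous f, continuous g, cancel f g & cancel g f].

(* The vertex set of K is all of V.  The empty simplex may or may not be listed
   in K; it is never seen by the realization or by a facet of a sphere. *)
Definition simplicial_complex (V : finType) (K : {set {set V}}) : Prop :=
  (forall v : V, [set v]%SET \in K) /\
  (forall s t : {set V}, s \in K -> t \subset s -> t \in K).

Definition facet (V : finType) (K : {set {set V}}) (s : {set V}) : Prop :=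
  maxset (fun t : {set V} => t \in K) s.

(* Barycentric coordinates: the points of R^V that are convex combinations of
   the vertices of some simplex, with the topology induced from R^V. *)
Definition realization (R : realType) (V : finType) (K : {set {set V}}) :
    set {ptws V -> R} :=
  [set x : {ptws V -> R} | [/\ forall v, 0 <= x v, \sum_v x v = 1 &
     [set v | x v != 0]%SET \in K]]%classic.

(* The norm of the library on 'cV[R]_4 is the sup norm, hence the explicit sum
   of squares; the induced topology is the usual one. *)
Definition sphere3 (R : realType) : set 'cV[R]_4 :=
  [set x : 'cV[R]_4 | \sum_i x i 0 ^+ 2 = 1]%classic.

Definition simplicial_3sphere (R : realType) (V : finType)
    (K : {set {set V}}) : Prop :=
  simplicial_complex K /\
  homeomorphic (set_type (@realization R V K)) (set_type (@sphere3 R)).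

(* The family of the f i, for i in A, is a basis of the module M. *)
Definition is_basis (R : nzRingType) (M : lmodType R) (I : finType)
    (A : {set I}) (f : I -> M) : Prop :=
  (forall w : M, exists c : I -> R, w = \sum_(i in A) c i *: f i) /\
  (forall c : I -> R, \sum_(i in A) c i *: f i = 0 ->
     forall i, i \in A -> c i = 0).

(* Taken at R = 'F_2 for mod 2 and at R = int for integral characteristic maps.
   The basis condition forces every facet to have exactly four vertices. *)
Definition characteristic_map (R : nzRingType) (V : finType)
    (K : {set {set V}}) (l : V -> 'cV[R]_4) : Prop :=
  forall s : {set V}, facet K s -> is_basis s l.

Definition orientable (V : finType) (l : V -> 'cV['F_2]_4) : Prop :=
  exists2 g : 'M['F_2]_4, g \in unitmx &
    forall v : V, \sum_i (g *m l v) i 0 = 1.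

Definition is_lift (V : finType) (K : {set {set V}}) (lR : V -> 'cV['F_2]_4)
    (l : V -> 'cV[int]_4) : Prop :=
  characteristic_map K l /\ forall v : V, map_mx intr (l v) = lR v.

(* Main.v *)
Require Import Defs.
From mathcomp Require Import all_boot all_order all_algebra.
From mathcomp Require Import all_classical all_reals all_analysis.
From mathcomp Require Import fingroup perm.

(** Orientability puts the mod 2 vectors in an affine hyperplane: after a change
    of basis [h] of F_2^4 every vertex has first coordinate 1, so its other
    coordinates form a point of the cube {0,1}^3.  Lift each such vector to the
    integer vector with the same coordinates 0 and 1.  On a facet this gives an
    integer 4x4 matrix whose determinant is the normalized volume of a
    tetrahedron with vertices in the cube, hence at most 2 in absolute value
    ([det4_cube]).  The determinant is odd, since the mod 2 matrix is
    invertible, so it is 1 or -1 and the four vectors form a basis of Z^4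
    ([unitmx_cube]).  Finally [h] is undone over the integers: every invertible
    matrix over F_2 is the reduction of a unimodular one ([unitmx_lift]).
    The lift of a vertex thus depends on its mod 2 vector alone: the eight
    vectors of the hyperplane are lifted once and for all. *)

Set Implicit Arguments.
Unset Strict Implicit.
Unset Printing Implicit Defensive.

Import Order.TTheory GRing.Theory Num.Theory.
Local Open Scope ring_scope.

Definition frame_mx (R : nzRingType) (V : Type) (n : nat) (e : 'I_n -> V)
    (f : V -> 'cV[R]_n) : 'M[R]_n := \matrix_(i, j) f (e j) i 0.

Lemma sum_frame (R : comNzRingType) (V : finType) (s : {set V}) (n : nat)
    (e : 'I_n -> V) (f : V -> 'cV[R]_n) (c : V -> R) :
  injective e -> [set e j | j in 'I_n]%SET = s ->
  \sum_(v in s) c v *: f v = frame_mx e f *m \col_j c (e j).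
Proof.
move=> e_inj <-; rewrite big_imset; last by move=> i j _ _ /e_inj.
apply/colP => i; rewrite summxE !mxE; apply: eq_bigr => j _.
by rewrite !mxE mulrC.
Qed.

Lemma is_basis_unitmx (R : comUnitRingType) (V : finType) (s : {set V})
    (n : nat) (e : 'I_n -> V) (f : V -> 'cV[R]_n) :
  injective e -> [set e j | j in 'I_n]%SET = s ->
  is_basis s f <-> frame_mx e f \in unitmx.
Proof.
move=> e_inj e_s; split=> [[span _]|M_unit].
  (* Expanding the unit vectors on the family gives a right inverse. *)
  have [B MB1] : exists B, frame_mx e f *m B = 1%:M.
    have /(_ _)/boolp.cid Bj (j : 'I_n) :
        exists b, frame_mx e f *m b = col j 1%:M.
      have [c def_c] := span (col j 1%:M).
      by exists (\col_j c (e j)); rewrite -(sum_frame _ _ e_inj e_s).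
    exists (\matrix_(i, j) sval (Bj j) i 0); apply/matrixP=> i j.
    have /colP/(_ i) := svalP (Bj j); rewrite !mxE => <-.
    by apply: eq_bigr => k _; rewrite mxE.
  by have [] := mulmx1_unit MB1.
have coef_of (b : 'cV[R]_n) : exists c : V -> R, \col_j c (e j) = b.
  exists (fun v => \sum_(j | e j == v) b j 0).
  apply/colP=> j; rewrite mxE (big_pred1 j) // => k.
  by rewrite (inj_eq e_inj).
split=> [w | c].
  have [c def_c] := coef_of (invmx (frame_mx e f) *m w).
  by exists c; rewrite (sum_frame _ _ e_inj e_s) def_c mulKVmx.
rewrite (sum_frame _ _ e_inj e_s) => Mc0 v; rewrite -e_s => /imsetP[j _ ->].
have /colP/(_ j) : \col_j c (e j) = 0.
  by rewrite -[LHS](mulKmx M_unit) Mc0 mulmx0.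
by rewrite !mxE.
Qed.

(** A basis of F^n has n elements because its matrix is both row-full and
    row-free; an enumeration by ['I_n] follows. *)
Lemma basis_frame (F : fieldType) (V : finType) (s : {set V}) (n : nat)
    (f : V -> 'cV[F]_n) :
  is_basis s f ->
  exists2 e : 'I_n -> V, injective e & [set e j | j in 'I_n]%SET = s.
Proof.
move=> [span free].
(* The vectors are laid out as rows, to use row spaces. *)
pose M := \matrix_(k < #|s|) (f (enum_val k))^T.
have sumE (c : V -> F) :
    (\sum_(v in s) c v *: f v)^T = \row_k c (enum_val k) *m M.
  rewrite big_enum_val mulmx_sum_row linear_sum; apply: eq_bigr => k _.
  by rewrite mxE rowK linearZ.
have M_full : row_full M.
  rewrite -sub1mx; apply/row_subP=> i.
  have [c def_c] := span (row i 1%:M)^T.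
  by rewrite -[row i _]trmxK def_c sumE submxMl.
have M_free : row_free M.
  rewrite -kermx_eq0; apply/rowV0P=> u /sub_kermxP uM0.
  pose c v := \sum_(k | enum_val k == v) u 0 k.
  have cE k : c (enum_val k) = u 0 k.
    by rewrite /c (big_pred1 k) // => l; rewrite (inj_eq enum_val_inj).
  have c0 : \sum_(v in s) c v *: f v = 0.
    apply: trmx_inj; rewrite sumE trmx0 -[RHS]uM0; congr (_ *m _).
    by apply/rowP=> k; rewrite mxE cE.
  by apply/rowP=> k; rewrite mxE -cE (free c c0) ?enum_valP.
have card_s : n = #|s|.
  by rewrite -(eqP M_free) (eqP M_full).
exists (fun j => enum_val (cast_ord card_s j)).
  by move=> i j /enum_val_inj/cast_ord_inj.
apply/setP=> v; apply/imsetP/idP=> [[j _ ->]|v_s]; first exact: enum_valP.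
exists (cast_ord (esym card_s) (enum_rank_in v_s v)) => //.
by rewrite cast_ordKV enum_rankK_in.
Qed.

Definition lift01 (m n : nat) (A : 'M['F_2]_(m, n)) : 'M[int]_(m, n) :=
  map_mx (fun a => (a != 0)%:R) A.

Lemma lift01K (m n : nat) (A : 'M['F_2]_(m, n)) : map_mx intr (lift01 A) = A.
Proof.
apply/matrixP=> i j; rewrite !mxE.
by case: (A i j) => [[|[|]]] // lt_i; apply/val_inj.
Qed.

Lemma F2_neq0 (a : 'F_2) : a != 0 -> a = 1.
Proof. by case: a => [[|[|]]] // lt_i _; apply/val_inj. Qed.

(** In an LUP decomposition over F_2 the triangular factors are unitriangular,
    as 1 is the only unit; so their 0/1 lifts still have determinant 1. *)
Lemma unitmx_lift (n : nat) (A : 'M['F_2]_n.+1) :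
  A \in unitmx ->
  exists2 B : 'M[int]_n.+1, B \in unitmx & map_mx intr B = A.
Proof.
move=> A_unit.
have := cormen_lup_perm A; have := cormen_lup_correct A.
have := @cormen_lup_lower _ _ A; have := @cormen_lup_upper _ _ A.
have := cormen_lup_detL A.
case: (cormen_lup A) => [[P L] U] /= detL upU lowL PA /is_perm_mxP[s defP].
have detU : \det U != 0.
  have : L * U \in unitmx by rewrite -PA defP unitmx_mul unitmx_perm.
  by rewrite unitmx_mul => /andP[_]; rewrite unitmxE unitfE.
have U1 i : U i i = 1.
  apply: F2_neq0; apply: contraNneq detU => Uii0.
  rewrite -det_tr det_trig; first by rewrite (bigD1 i) //= mxE Uii0 mul0r.
  by apply/is_trig_mxP=> j k lt_jk; rewrite mxE upU.
have L1 : \det (lift01 L) = 1.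
  rewrite det_trig => [|]; last first.
    apply/is_trig_mxP=> i j lt_ij.
    have neq_ij : (i == j) = false by rewrite -val_eqE ltn_eqF.
    by rewrite mxE lowL ?(ltnW lt_ij) // neq_ij eqxx.
  by rewrite big1 // => i _; rewrite mxE lowL // eqxx.
have dU1 : \det (lift01 U) = 1.
  rewrite -det_tr det_trig => [|]; last first.
    by apply/is_trig_mxP=> i j lt_ij; rewrite !mxE upU.
  by rewrite big1 // => i _; rewrite !mxE U1.
exists (perm_mx s^-1%g *m (lift01 L *m lift01 U)).
  by rewrite !unitmx_mul unitmx_perm !unitmxE L1 dU1 unitr1.
rewrite !map_mxM map_perm_mx !lift01K -[L *m U]PA defP.
by rewrite -mulmxE mulmxA -perm_mxM mulVg perm_mx1 mul1mx.
Qed.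

Definition mx01 (m n : nat) (A : 'M[int]_(m, n)) : Prop :=
  forall i j, A i j = 0 \/ A i j = 1.

(** The determinant has three positive and three negative monomials.  Three
    monomials of the same sign involve all nine entries, so if they are all
    equal to 1 then so are the other three: a difference of 3 is excluded. *)
Lemma det3_01 (N : 'M[int]_3) : mx01 N -> `|\det N| <= 2.
Proof.
move=> N01; pose b (i j : nat) : bool := N (inord i) (inord j) == 1.
have -> : N = \matrix_(i, j) (b i j)%:R.
  by apply/matrixP=> i j; rewrite mxE /b !inord_val; case: (N01 i j) => ->.
(* Fully expanded, the bound is checked on the 2^9 matrices of bits. *)
rewrite (expand_det_row _ 0) !big_ord_recl big_ord0.
rewrite /cofactor !(expand_det_row _ 0) !big_ord_recl !big_ord0.
rewrite /cofactor !det_mx11 !mxE /= /bump /=.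
move: (b 0 0)%N (b 0 1)%N (b 0 2)%N (b 1 0)%N (b 1 1)%N (b 1 2)%N
  (b 2 0)%N (b 2 1)%N (b 2 2)%N.
by do 9 case.
Qed.

(** Subtracting the first column from the others reduces to the 3x3 matrix [D]
    of the edge vectors at one vertex of the tetrahedron.  As a row of [D] is a
    difference of bits with the same subtrahend, its entries are all in {0,1}
    or all in {0,-1}; a reflection of the cube makes them all 0 or 1. *)
Lemma det4_cube (A : 'M[int]_(1 + 3)) :
  mx01 A -> (forall j, A 0 j = 1) -> `|\det A| <= 2.
Proof.
move=> A01 A1; set p := dlsubmx A.
pose D := drsubmx A - p *m const_mx 1.
have -> : \det A = \det D.
  have ul1 : ulsubmx A = 1%:M.
    by apply/matrixP=> i j; rewrite !mxE !ord1 lshift0 A1.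
  have ur1 : ursubmx A = const_mx 1.
    by apply/matrixP=> i j; rewrite !mxE !ord1 lshift0 A1.
  have := det_mulmx A (block_mx 1%:M (- const_mx 1) 0 1%:M).
  rewrite det_ublock !det1 mul1r mulr1 => <-.
  rewrite -[A in LHS]submxK mulmx_block ul1 ur1 !mul1mx !mulmx1 !mulmx0 !addr0.
  by rewrite addNr mulmxN det_lblock det1 mul1r addrC.
pose sgn i : int := if p i 0 == 0 then 1 else -1.
have sgn1 : `|\det (diag_mx (\row_i sgn i))| = 1.
  rewrite det_diag normr_prod big1 // => i _; rewrite mxE /sgn.
  by case: ifP; rewrite ?normrN normr1.
rewrite -[leLHS]mul1r -[X in X * _]sgn1 -normrM -det_mulmx.
apply: det3_01 => i j.
rewrite mul_diag_mx !mxE big_ord1 !mxE /sgn /p !mxE mulr1.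
by case: (A01 (rshift 1 i) (lshift 3 0)) => ->;
  case: (A01 (rshift 1 i) (rshift 1 j)) => ->; by [left|right].
Qed.

Lemma unitmx_cube (B : 'M['F_2]_4) :
  B \in unitmx -> (forall j, B 0 j = 1) -> lift01 B \in unitmx.
Proof.
move=> B_unit B1.
have det_le2 : `|\det (lift01 B)| <= 2.
  apply: det4_cube => [i j | j]; last by rewrite mxE B1.
  by rewrite mxE; case: (_ != 0); [right | left].
have det_odd : (\det (lift01 B))%:~R != 0 :> 'F_2.
  by rewrite -det_map_mx lift01K -unitfE -unitmxE.
rewrite unitmxE; move: (\det _) det_le2 det_odd => [[|[|[|n]]]|[|[|n]]] //.
Qed.

(** The coordinate sum of [g *m lR v] becomes the first coordinate once the
    matrix [T] has added the other coordinates to the first. *)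
Lemma orientable_first_coord (V : finType) (lR : V -> 'cV['F_2]_4) :
  orientable lR ->
  exists2 h : 'M['F_2]_4, h \in unitmx & forall v, (h *m lR v) 0 0 = 1.
Proof.
case=> g g_unit g_odd.
pose T : 'M['F_2]_(1 + 3) := block_mx 1%:M (const_mx 1) 0 1%:M.
have T_unit : T \in unitmx.
  by rewrite unitmxE det_ublock !det1 mulr1 unitr1.
have T_row j : T 0 j = 1.
  rewrite -[0](lshift0 3 0); case: (split_ordP j) => k ->.
    by rewrite block_mxEul !ord1 mxE.
  by rewrite block_mxEur mxE.
exists (T *m g) => [|v].
  by rewrite unitmx_mul T_unit g_unit.
rewrite -mulmxA -[RHS](g_odd v) mxE; apply: eq_bigr => j _.
by rewrite T_row mul1r.
Qed.

Theorem corollary3p7 (R : realType) (V : finType) (K : {set {set V}})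
    (lR : V -> 'cV['F_2]_4) :
  simplicial_3sphere R K -> characteristic_map K lR -> orientable lR ->
  exists l : V -> 'cV[int]_4, is_lift K lR l.
Proof.
move=> _ lR_char /orientable_first_coord[h h_unit h1].
have [H H_unit H_lift] : exists2 H : 'M[int]_4, H \in unitmx &
    map_mx intr H = invmx h.
  by apply: unitmx_lift; rewrite unitmx_inv.
exists (fun v => H *m lift01 (h *m lR v)); split=> [s /lR_char s_basis | v].
  have [e e_inj e_s] := basis_frame s_basis.
  apply/(is_basis_unitmx _ e_inj e_s).
  have -> : frame_mx e (fun v => H *m lift01 (h *m lR v)) =
      H *m lift01 (h *m frame_mx e lR).
    apply/matrixP=> i j; rewrite !mxE; apply: eq_bigr => k _.
    rewrite !mxE; congr (_ * (_ != 0)%:R).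
    by apply: eq_bigr => m _; rewrite mxE.
  rewrite unitmx_mul H_unit unitmx_cube // => [|j].
    by rewrite unitmx_mul h_unit; apply/(is_basis_unitmx _ e_inj e_s).
  by rewrite -(h1 (e j)) !mxE; apply: eq_bigr => k _; rewrite mxE.
by rewrite map_mxM lift01K H_lift mulKmx.
Qed.
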